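(* Let $T>0$ and let $f_0,f_T:\mathbb R\to\mathbb R$ be smooth. Let $v:\mathbb R\to\mathbb R$ be a (locally integrable) function satisfying the recurrence relation $$v(x+T)=v(x-T)+2f_T'(x)-f_0'(x+T)-f_0'(x-T)\qquad\text{for all }x\in\mathbb R,$$ and let $u$ be the function induced by $v$. Then $u$ is a $C^2$ solution of the two-point boundary value problem with input $v$ (i.e. $u\in C^2([0,T]\times\mathbb R)$, $u_{tt}-u_{xx}=0$, $u(0,x)=f_0(x)$, $u(T,x)=f_T(x)$ and $u_t(0,x)=v(x)$ for all $x\in\mathbb R$) if and only if the restriction of $v$ to $[-T,T]$ meets the following requirements: 1. $\displaystyle\int_{-T}^{T}v(x)\,dx=2f_T(0)-f_0(T)-f_0(-T)$; 2. $v$ is $C^1$ on $[-T,T]$; 3. $v(T)=v(-T)+2f_T'(0)-f_0'(T)-f_0'(-T)$ and $v'(T)=v'(-T)+2f_T''(0)-f_0''(T)-f_0''(-T)$, where the derivatives of $v|_{[-T,T]}$ at $\pm T$ are one-sided.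
   Context: Two-point boundary value problem (TBVP), with wave speed normalized to $1$: given smooth $f_0,f_T:\mathbb R\to\mathbb R$ and $T>0$, find $u\in C^2([0,T]\times\mathbb R)$ with $u_{tt}-u_{xx}=0$, $u(0,x)=f_0(x)$, $u(T,x)=f_T(x)$. Such a $u$ is called a solution, and its input is the function $v(x)=u_t(0,x)$. The function induced by an input $v$ is given by d'Alembert's formula $$u(t,x)=\tfrac12\big(f_0(x+t)+f_0(x-t)\big)+\tfrac12\int_{x-t}^{x+t}v(s)\,ds,\qquad (t,x)\in[0,T]\times\mathbb R.$$ *)

(* Defs.v *)
From HB Require Import structures.
From mathcomp Require Import all_boot all_order all_algebra.
From mathcomp Require Import all_classical all_reals all_analysis.
Set Implicit Arguments.
Unset Strict Implicit.
Unset Printing Implicit Defensive.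
Import Order.TTheory GRing.Theory Num.Theory.
Import numFieldNormedType.Exports.
Local Open Scope ring_scope.
Local Open Scope classical_set_scope.

Definition smooth (R : realType) (f : R -> R) : Prop :=
  forall (n : nat) (x : R), derivable (derive1n n f) x 1.

(* A Lebesgue-measurable function is one that agrees almost everywhere with a
   Borel function; [locally_integrable] itself asks for Borel measurability.
   The library integral against [lebesgue_measure] is still the Lebesgue
   integral for such a function, because its positive and negative parts have
   nonnegative Borel minorants equal to them almost everywhere. *)
Definition loc_integrable (R : realType) (v : R -> R) : Prop :=
  exists2 w : R -> R, locally_integrable setT w &
    {ae (@lebesgue_measure R), forall x, v x = w x}.

(* Difference quotients taken inside [D]: on an interval with nonempty interior
   this is the ordinary derivative at interior points and the one-sided
   derivative at endpoints. *)
Definition diff_quot (R : realType) (f : R -> R) (x y : R) : R :=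
  (f y - f x) / (y - x).

Definition derivable_within (R : realType) (D : set R) (f : R -> R) (x : R) :
    Prop :=
  cvg (diff_quot f x y @[y --> within D x^']).

Definition derive_within (R : realType) (D : set R) (f : R -> R) (x : R) : R :=
  lim (diff_quot f x y @[y --> within D x^']).

Definition C1_segment (R : realType) (a b : R) (f : R -> R) : Prop :=
  [/\ {within `[a, b], continuous f},
      {in `[a, b], forall x, derivable_within `[a, b] f x} &
      {within `[a, b], continuous (derive_within `[a, b] f)}].

(* Functions on [0, T] x R are represented by u : R -> R -> R (time first);
   the notions below only look at the values u t x with 0 <= t <= T. *)
Definition dt (R : realType) (T : R) (u : R -> R -> R) : R -> R -> R :=
  fun t x => derive_within `[0, T] (u ^~ x) t.

Definition dx (R : realType) (u : R -> R -> R) : R -> R -> R :=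
  fun t x => derive1 (u t) x.

Definition C0_strip (R : realType) (T : R) (u : R -> R -> R) : Prop :=
  {within [set p : R * R | 0 <= p.1 <= T], continuous (fun p => u p.1 p.2)}.

Fixpoint Ck_strip (R : realType) (T : R) (k : nat) (u : R -> R -> R) : Prop :=
  if k is k'.+1 then
    [/\ C0_strip T u,
        forall t x : R, 0 <= t <= T ->
          derivable_within `[0, T] (u ^~ x) t /\ derivable (u t) x 1,
        Ck_strip T k' (dt T u) &
        Ck_strip T k' (dx u)]
  else C0_strip T u.

Record TBVP_solution (R : realType) (T : R) (f0 fT : R -> R)
    (u : R -> R -> R) : Prop := {
  TBVP_C2 : Ck_strip T 2 u ;
  TBVP_wave : forall t x : R, 0 <= t <= T ->
    dt T (dt T u) t x - dx (dx u) t x = 0 ;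
  TBVP_init : forall x : R, u 0 x = f0 x ;
  TBVP_final : forall x : R, u T x = fT x }.

Definition has_input (R : realType) (T : R) (u : R -> R -> R) (v : R -> R) :
    Prop :=
  forall x : R, dt T u 0 x = v x.

Definition induced_function (R : realType) (f0 v : R -> R) : R -> R -> R :=
  fun t x => 2^-1 * (f0 (x + t) + f0 (x - t)) +
    2^-1 * \int[@lebesgue_measure R]_(s in `[x - t, x + t]) v s.

(* Main.v *)
Require Import Defs.
From HB Require Import structures.
From mathcomp Require Import all_boot all_order all_algebra.
From mathcomp Require Import all_classical all_reals all_analysis.
From mathcomp Require Import ring lra.
Set Implicit Arguments.
Unset Strict Implicit.
Unset Printing Implicit Defensive.
Import Order.TTheory GRing.Theory Num.Theory.
Import numFieldNormedType.Exports.
Local Open Scope ring_scope.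
Local Open Scope classical_set_scope.

(** The solution induced by v is a sum of two travelling waves.  If V is an
antiderivative of v, d'Alembert's formula reads u(t,x) = F(x+t) + G(x-t) with
F = (f0 + V)/2 and G = (f0 - V)/2, so u is as smooth as F and G, that is, one
degree smoother than v; u solves the wave equation because the two time
derivatives of G(x-t) bring the sign (-1)^2, and u_t(0,.) = F' - G' = v.
This makes the problem one about v on the whole line.

The equivalence then rests on two facts.

- Regularity ([C1_recurrenceP]).  The recurrence says that v(x+2T) - v(x) is
  the smooth function g(x) = 2 fT'(x+T) - f0'(x+2T) - f0'(x).  Hence v is C^1
  on the line exactly when it is C^1 on the period interval [-T,T] and the
  one-sided derivatives at the two endpoints differ by g'(-T): right of T, v
  is a copy of v near -T shifted by 2T plus g, so this condition says that the
  two pieces meeting at T have the same derivative there, and translation by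
  multiples of 2T carries the result everywhere.

- The final value ([induced_solution]).  The derivative of u(T,.) is
  (f0'(x+T) + f0'(x-T) + v(x+T) - v(x-T))/2, which the recurrence equates with
  fT'(x).  So u(T,.) and fT differ by a constant, and the integral condition
  is the statement u(T,0) = fT(0) that makes this constant zero.

Conversely the input of a C^2 solution is u_t(0,.), a C^1 function of x
([input_C1]).  The integral condition is then u(T,0) = fT(0), the relation
between v(T) and v(-T) is the recurrence at x = 0, and the one between the
derivatives is the derivative of the recurrence at x = 0. *)

Section Calculus.
Context {R : realType}.
Implicit Types (f g v : R -> R) (a b x l : R).
Local Notation mu := (@lebesgue_measure R).

(** * Ordinary and one-sided derivatives *)

(** Ordinary derivatives are limits in an increment h tending to 0, one-sided
ones are limits in a second point y tending to x; the substitution y = x + h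
lets the two be compared. *)
Lemma is_deriveP f x l :
  is_derive x 1 f l <-> diff_quot f x y @[y --> x^'] --> l.
Proof.
have E1 : (fun h : R => h^-1 *: ((f \o shift x) (h *: 1) - f x))
    = (fun h => diff_quot f x (h + x)).
  by apply/funext => h; rewrite /diff_quot /= scaler1 addrK mulrC.
have E2 : diff_quot f x y @[y --> x^'] = diff_quot f x (h + x) @[h --> 0^'].
  apply/funext => A.
  rewrite -[LHS]/(nbhs x [set y | y != x -> A (diff_quot f x y)]).
  rewrite -[RHS]/(nbhs 0 [set h | h != 0 -> A (diff_quot f x (h + x))]).
  rewrite [LHS](near_shift (0 : R) x [set y | y != x -> A (diff_quot f x y)]) subr0.
  congr (nbhs (0 : R) _); apply/funext => h /=.
  by have -> : (h + x == x) = (h == 0) by rewrite -subr_eq0 addrK.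
rewrite E2 -E1; split=> [[df <-]|H]; first exact: df.
by apply: DeriveDef; [apply/cvg_ex; exists l | exact/cvg_lim].
Qed.

Lemma derivable_is_derive1 f x : derivable f x 1 -> is_derive x 1 f (f^`() x).
Proof. by move=> df; apply: DeriveDef => //; rewrite derive1E. Qed.

Lemma is_derive_derive1 f x l : is_derive x 1 f l -> f^`() x = l.
Proof. by move=> df; rewrite derive1E derive_val. Qed.

(** The next three inclusions turn a limit taken inside a segment into a
one-sided limit at an endpoint and an ordinary limit at an interior point. *)
Lemma at_left_within a b : a < b ->
  within `[a, b] b^' `<=` nbhs b^'-.
Proof.
move=> ab U UE; have : \forall y \near within `[a, b] b^', U y by [].
rewrite 2!near_withinE => {}UE.
suff : \forall y \near b^'-, U y by [].
rewrite /at_left near_withinE.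
apply: filterS2 UE (lt_nbhsr ab) => y /= Uy ay yb.
by apply: Uy; rewrite ?lt_eqF // in_itv /= !ltW.
Qed.

Lemma at_right_within a b : a < b ->
  within `[a, b] a^' `<=` nbhs a^'+.
Proof.
move=> ab U UE; have : \forall y \near within `[a, b] a^', U y by [].
rewrite 2!near_withinE => {}UE.
suff : \forall y \near a^'+, U y by [].
rewrite /at_right near_withinE.
apply: filterS2 UE (lt_nbhsl ab) => y /= Uy yb ay.
by apply: Uy; rewrite ?gt_eqF // in_itv /= !ltW.
Qed.

Lemma dnbhs_within a b x : a < x < b -> within `[a, b] x^' `<=` x^'.
Proof.
move=> /andP[ax xb] U UE; have : \forall y \near within `[a, b] x^', U y by [].
rewrite 2!near_withinE => {}UE.
suff : \forall y \near x^', U y by [].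
rewrite near_withinE.
apply: filterS3 UE (lt_nbhsr ax) (lt_nbhsl xb) => y /= Uy ay yb yx.
by apply: Uy => //=; rewrite in_itv /= !ltW.
Qed.

(** Properness is what makes the limit defining a derivative within the
segment unique. *)
Lemma within_itv_proper a b x : a < b -> a <= x <= b ->
  ProperFilter (within `[a, b] x^').
Proof.
move=> ab /andP[ax xb].
split; last exact: within_filter.
move: ax; rewrite le_eqVlt => /orP[/eqP ax|ax].
  move: ab; rewrite ax => xb'; move/(at_right_within xb') => /=.
  exact: (@filter_not_empty _ _ (at_right_proper_filter x)).
move: xb; rewrite le_eqVlt => /orP[/eqP xb|xb].
  move: ab; rewrite -xb => ax'; move/(at_left_within ax') => /=.
  exact: (@filter_not_empty _ _ (at_left_proper_filter x)).
have /dnbhs_within : a < x < b by rewrite ax.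
move=> /[apply].
exact: (@filter_not_empty _ x^' (Proper_dnbhs_numFieldType x)).
Qed.

Lemma cvg_derivable_within a b f x l : a < b -> a <= x <= b ->
  diff_quot f x y @[y --> within `[a, b] x^'] --> l ->
  derivable_within `[a, b] f x /\ derive_within `[a, b] f x = l.
Proof.
move=> ab axb H; have PF := within_itv_proper ab axb.
by split; [apply/cvg_ex; exists l | exact/cvg_lim].
Qed.

(** Only the values on the segment matter, so f may be replaced there by a
function differentiable in the ordinary sense. *)
Lemma is_derive_within a b f g x l : a < b -> a <= x <= b ->
  (forall y, a <= y <= b -> f y = g y) -> is_derive x 1 g l ->
  derivable_within `[a, b] f x /\ derive_within `[a, b] f x = l.
Proof.
move=> ab axb fg /is_deriveP gl; apply: cvg_derivable_within => //.
have glab : diff_quot g x y @[y --> within `[a, b] x^'] --> l.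
  exact: cvg_within_filter gl.
apply: cvg_trans glab.
apply: fmap_within_eq => y; rewrite inE /= in_itv /= => ayb.
by rewrite /diff_quot !fg.
Qed.

Lemma C1_segment_is_derive a b f x : C1_segment a b f -> a < x < b ->
  is_derive x 1 f (derive_within `[a, b] f x).
Proof.
move=> [_ df _] axb; apply/is_deriveP.
have xab : x \in `[a, b] by apply: mem_set; rewrite /= in_itv /=; lra.
apply: cvg_trans (df _ xab).
exact/cvg_app/dnbhs_within.
Qed.

(** At the right endpoint the one-sided derivative is both the limit of the
difference quotients and, by continuity of the derivative on the segment, the
limit of the ordinary derivatives at interior points. *)
Lemma C1_segment_left a b f : a < b -> C1_segment a b f ->
  diff_quot f b y @[y --> b^'-] --> derive_within `[a, b] f b /\
  f^`() y @[y --> b^'-] --> derive_within `[a, b] f b.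
Proof.
move=> ab C1f; have [_ df cdf] := C1f; split.
  have bab : b \in `[a, b] by apply: mem_set; rewrite /= in_itv /= lexx ltW.
  by apply: cvg_trans (df _ bab); exact/cvg_app/at_left_within.
have [_ _ cb] := (continuous_within_itvP _ ab).1 cdf.
apply: cvg_trans cb; apply: near_eq_cvg; near=> y.
apply/esym/is_derive_derive1/C1_segment_is_derive => //.
by apply/andP; split.
Unshelve. all: by end_near. Qed.

Lemma C1_segment_right a b f : a < b -> C1_segment a b f ->
  diff_quot f a y @[y --> a^'+] --> derive_within `[a, b] f a /\
  f^`() y @[y --> a^'+] --> derive_within `[a, b] f a.
Proof.
move=> ab C1f; have [_ df cdf] := C1f; split.
  have aab : a \in `[a, b] by apply: mem_set; rewrite /= in_itv /= lexx ltW.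
  by apply: cvg_trans (df _ aab); exact/cvg_app/at_right_within.
have [_ ca _] := (continuous_within_itvP _ ab).1 cdf.
apply: cvg_trans ca; apply: near_eq_cvg; near=> y.
apply/esym/is_derive_derive1/C1_segment_is_derive => //.
by apply/andP; split.
Unshelve. all: by end_near. Qed.

Lemma C1_segment_continuous_derive1 a b f x : C1_segment a b f -> a < x < b ->
  {for x, continuous f^`()}.
Proof.
move=> C1f axb; have ab : a < b by lra.
have [_ _ cdf] := C1f; have [cx _ _] := (continuous_within_itvP _ ab).1 cdf.
have xab : x \in `]a, b[%R by rewrite in_itv.
rewrite /prop_for /continuous_at (is_derive_derive1 (C1_segment_is_derive C1f axb)).
apply: cvg_trans (cx _ xab); apply: near_eq_cvg; near=> y.
apply/esym/is_derive_derive1/C1_segment_is_derive => //.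
by apply/andP; split; near: y; [apply: lt_nbhsr|apply: lt_nbhsl]; case/andP: axb.
Unshelve. all: by end_near. Qed.

(** * Regularity on the line *)

Fixpoint Ck (k : nat) f : Prop :=
  if k is k'.+1 then (forall x, derivable f x 1) /\ Ck k' f^`()
  else continuous f.

Lemma derivable1_continuous f : (forall x, derivable f x 1) -> continuous f.
Proof. by move=> df x; apply/differentiable_continuous/derivable1_diffP. Qed.

Lemma Ck_continuous k f : Ck k f -> continuous f.
Proof. by case: k => [//|k] [/derivable1_continuous]. Qed.

Lemma CkN k f : Ck k f -> Ck k (fun x => - f x).
Proof.
elim: k f => [|k IH] f; first by move=> cf x; apply: cvgN; exact: cf.
move=> [df cf]; have D x : is_derive x 1 (fun y => - f y) (- derive1 f x).
  by apply: is_deriveN; exact: derivable_is_derive1.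
split; first by move=> x; case: (D x).
rewrite (_ : (fun x => - f x)^`() = (fun x => - derive1 f x)); first exact: IH.
by apply/funext => x; exact: is_derive_derive1.
Qed.

Lemma CkD k f g : Ck k f -> Ck k g -> Ck k (fun x => f x + g x).
Proof.
elim: k f g => [|k IH] f g; first by move=> cf cg x; apply: cvgD; [exact: cf|exact: cg].
move=> [df cf] [dg cg].
have D x : is_derive x 1 (fun y => f y + g y) (derive1 f x + derive1 g x).
  by apply: is_deriveD; exact: derivable_is_derive1.
split; first by move=> x; case: (D x).
rewrite (_ : (fun x => f x + g x)^`() = (fun x => derive1 f x + derive1 g x)).
  exact: IH.
by apply/funext => x; exact: is_derive_derive1.
Qed.

Lemma CkZ k (c : R) f : Ck k f -> Ck k (fun x => c * f x).
Proof.
elim: k f => [|k IH] f; first by move=> cf x; apply: cvgMr; exact: cf.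
move=> [df cf]; have D x : is_derive x 1 (fun y => c * f y) (c * derive1 f x).
  by apply: (@is_deriveZ _ _ _ f); exact: derivable_is_derive1.
split; first by move=> x; case: (D x).
rewrite (_ : (fun x => c * f x)^`() = (fun x => c * derive1 f x)); first exact: IH.
by apply/funext => x; exact: is_derive_derive1.
Qed.

Lemma is_derive_translate f p x l :
  is_derive (x + p) 1 f l <-> is_derive x 1 (fun y => f (y + p)) l.
Proof.
split=> H.
  by rewrite -[l]mulr1; apply: (@is_derive1_comp _ f (shift p)); exact: is_derive_shift.
suff -> : f = (fun y => f (y + p)) \o (shift (- p)).
  rewrite -[l]mulr1; apply: is_derive1_comp; last exact: is_derive_shift.
  by rewrite /= addrK.
by apply/funext => y; rewrite /= subrK.
Qed.

Lemma Ck_translate k (c : R) f : Ck k f -> Ck k (fun x => f (x + c)).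
Proof.
elim: k f => [|k IH] f.
  move=> cf x; apply: (@continuous_comp _ _ _ (fun y => y + c) f); last exact: cf.
  by apply: cvgD; [exact: cvg_id|exact: cvg_cst].
move=> [df cf]; have D x : is_derive x 1 (fun y => f (y + c)) (derive1 f (x + c)).
  exact: (is_derive_translate f c x _).1 (derivable_is_derive1 (df _)).
split; first by move=> x; case: (D x).
rewrite (_ : (fun x => f (x + c))^`() = (fun x => derive1 f (x + c))); first exact: IH.
by apply/funext => x; exact: is_derive_derive1.
Qed.

Lemma smooth_derive1n n f : smooth f -> smooth (derive1n n f).
Proof. by move=> sf m x; have := sf (m + n)%N x; rewrite /derive1n iterD. Qed.

Lemma smooth_Ck k f : smooth f -> Ck k f.
Proof.
elim: k f => [|k IH] f sf; first exact/derivable1_continuous/(sf 0).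
split; first exact: (sf 0).
exact: (IH _ (@smooth_derive1n 1 f sf)).
Qed.

Lemma C1_line_segment a b f : a < b -> Ck 1 f ->
  C1_segment a b f /\ forall x, a <= x <= b -> derive_within `[a, b] f x = f^`() x.
Proof.
move=> ab [df cf]; have D x : a <= x <= b ->
    derivable_within `[a, b] f x /\ derive_within `[a, b] f x = f^`() x.
  by move=> xab; apply: is_derive_within (derivable_is_derive1 (df x)).
split; last by move=> x /D[].
split; first exact/continuous_subspaceT/derivable1_continuous.
  by move=> x; rewrite inE /= in_itv => /D[].
apply: (@subspace_eq_continuous _ _ _ f^`()); last exact: continuous_subspaceT.
by move=> x; rewrite inE /= in_itv => /D[_ /esym].
Qed.

Lemma derive1_inj_at0 f g : (forall x, derivable f x 1) -> (forall x, derivable g x 1) ->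
  f^`() = g^`() -> f 0 = g 0 -> f = g.
Proof.
move=> df dg fg fg0; apply/funext => x; apply/eqP; rewrite -subr_eq0.
have -> : f x - g x = f 0 - g 0.
  apply: (@is_derive_0_is_cst _ (fun y => f y - g y)) => y.
  have -> : 0 = derive1 f y - derive1 g y by rewrite fg subrr.
  by apply: is_deriveB; exact: derivable_is_derive1.
by rewrite fg0 subrr.
Qed.

(** * Functions satisfying a recurrence *)

Lemma is_derive_recurrence f g p x : derivable g x 1 ->
  (forall y, f (y + p) = f y + g y) ->
  forall l, is_derive x 1 f l <-> is_derive (x + p) 1 f (l + derive1 g x).
Proof.
move=> /derivable_is_derive1 dg fg l; rewrite is_derive_translate.
rewrite (_ : (fun y => f (y + p)) = f \+ g); last exact/funext.
split=> H; first exact: is_deriveD.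
have -> : f = (f \+ g) \- g by apply/funext => y /=; rewrite addrK.
by rewrite -[l](addrK (derive1 g x)); exact: is_deriveB.
Qed.

Lemma derive1_recurrence f g p x : derivable f x 1 -> derivable g x 1 ->
  (forall y, f (y + p) = f y + g y) ->
  derive1 f (x + p) = derive1 f x + derive1 g x.
Proof.
move=> /derivable_is_derive1 df dg fg; apply: is_derive_derive1.
exact: (is_derive_recurrence dg fg _).1.
Qed.

Lemma at_right_shift a p : (y - p) @[y --> (a + p)^'+] --> a^'+.
Proof.
have c : (y - p) @[y --> a + p] --> a.
  by rewrite -[X in _ --> X](addrK p a); apply: cvgB; [exact: cvg_id|exact: cvg_cst].
move=> U UE; have : \forall y \near a^'+, U y by [].
rewrite /at_right near_withinE => {}UE.
suff : \forall y \near (a + p)^'+, U (y - p) by [].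
rewrite /at_right near_withinE.
have : \forall y \near a + p, a < y - p -> U (y - p) by exact: c _ UE.
by apply: filterS => y /= + ay; apply; rewrite ltrBrDr.
Qed.

Lemma translation_ind (p a : R) (P : R -> Prop) : 0 < p ->
  (forall x, P x <-> P (x + p)) -> (forall x, a < x <= a + p -> P x) ->
  forall x, P x.
Proof.
move=> p0 Pp Pa x.
(* Climb or descend one period at a time from the fundamental interval. *)
have H (n : nat) : forall x, a - n%:R * p < x <= a + n.+1%:R * p -> P x.
  elim: n => [|n IH] z; first by rewrite mul0r mul1r subr0; exact: Pa.
  rewrite -[n.+2]addn1 -[n.+1]addn1 !natrD !mulrDl !mul1r => zn.
  have [z1|z1] := lerP z (a - n%:R * p).
    apply: (Pp _).2; apply: IH; rewrite -[n.+1]addn1 natrD mulrDl mul1r.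
    have : 0 <= n%:R * p by rewrite mulr_ge0 // ltW.
    lra.
  have [z2|z2] := lerP z (a + n.+1%:R * p); first by apply: IH; rewrite z1.
  rewrite -(subrK p z); apply: (Pp _).1; apply: IH; move: z2.
  rewrite -[n.+1]addn1 natrD mulrDl mul1r => z2.
  have : 0 <= n%:R * p by rewrite mulr_ge0 // ltW.
  lra.
have := archi_boundP (normr_ge0 ((x - a) / p)).
set n := Num.Def.archi_bound _; rewrite normrM normfV (gtr0_norm p0).
rewrite ltr_pdivrMr // ltr_norml => /andP[l1 l2].
apply: (H n); rewrite -[n.+1]addn1 natrD mulrDl mul1r; lra.
Qed.

(** Every point translates by a multiple of b - a into ]a, b], and points of
]a, b[ are settled by the hypothesis on the segment.  At b the segment controls
the left side; the right side is the recurrence applied to the right side of a,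
where v has one-sided derivative D a, and adding the derivative of g at a gives
the same value D b on both sides. *)
Lemma C1_glue (a b : R) (v g : R -> R) : a < b -> Ck 1 g ->
  (forall x, v (x + (b - a)) = v x + g x) ->
  C1_segment a b v ->
  derive_within `[a, b] v b = derive_within `[a, b] v a + derive1 g a ->
  Ck 1 v.
Proof.
move=> ab [dg cg] vg C1v Dab; set p := b - a in vg.
have p0 : 0 < p by rewrite subr_gt0.
have bE : b = a + p by rewrite /p subrKC.
have [lq ld] := C1_segment_left ab C1v.
have [rq rd] := C1_segment_right ab C1v.
have vb : v b = v a + g a by rewrite bE vg.
(* Differentiability at x and at x + p are equivalent. *)
have dv_shift x := is_derive_recurrence (dg x) vg.
have dv x : derivable v x 1.
  move: x; apply: (translation_ind p0 (a := a)) => [x|x].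
    split=> /derivable_is_derive1.
      by move=> /(dv_shift _ _).1 [].
    by rewrite -[derive1 v (x + p)](subrK (derive1 g x)) => /(dv_shift _ _).2 [].
  rewrite -bE => /andP[ax]; rewrite le_eqVlt => /orP[/eqP ->|xb]; last first.
    have axb : a < x < b by rewrite ax.
    by have [] := C1_segment_is_derive C1v axb.
  suff dvb : is_derive b 1 v (derive_within `[a, b] v b) by case: dvb.
  apply/is_deriveP; apply: (@cvg_at_right_left_dnbhs _ R^o (diff_quot v b) b
    (derive_within `[a, b] v b)); last exact: lq.
  (* For y > b, the recurrence moves the quotient of v at b to the one at a. *)
  have -> : diff_quot v b = fun y => diff_quot v a (y - p) + diff_quot g a (y - p).
    apply/funext => y; rewrite /diff_quot vb -[y in v y](subrK p) vg bE -mulrDl.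
    by congr (_ / _); ring.
  rewrite Dab; apply: cvgD.
    by apply: (cvg_comp _ _ _ rq); rewrite bE; exact: at_right_shift.
  have gq := (is_deriveP g a _).1 (derivable_is_derive1 (dg a)).
  apply: (@cvg_comp _ _ _ (fun y => y - p) (diff_quot g a) _ (a^'+)).
    by rewrite bE; exact: at_right_shift.
  have gab : diff_quot g a y @[y --> within `[a, b] a^'] --> derive1 g a.
    exact: cvg_within_filter gq.
  by apply: cvg_trans gab; exact/cvg_app/at_right_within.
have D_shift x := derive1_recurrence (dv x) (dg x) vg.
split; first exact: dv.
move=> x.
apply: (@translation_ind p a (fun x => {for x, continuous v^`()}) p0).
  move=> {}x; rewrite /prop_for /continuous_at -!cvg_comp_shift.
  have cgx := cg x.
  rewrite (_ : v^`() \o shift p = v^`() \+ g^`()); last exact/funext.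
  rewrite D_shift; split=> H; first exact: cvgD.
  have -> : v^`() = (v^`() \+ g^`()) \- g^`() by apply/funext => y /=; rewrite addrK.
  by rewrite /= ; apply: cvgB.
move=> {}x; rewrite -bE => /andP[ax]; rewrite le_eqVlt => /orP[/eqP ->|xb]; last first.
  by apply: C1_segment_continuous_derive1 C1v _; rewrite ax.
apply/left_right_continuousP.
have -> : v^`() b = derive_within `[a, b] v b.
  apply: is_derive_derive1; have /derivable_is_derive1 db := dv b.
  suff -> : derive_within `[a, b] v b = v^`() b by [].
  have bab : a <= b <= b by rewrite lexx ltW.
  by have [] := is_derive_within ab bab (fun _ _ => erefl) db.
split; first exact: ld.
have -> : v^`() = fun y => derive1 v (y - p) + derive1 g (y - p).
  by apply/funext => y; rewrite -D_shift subrK.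
rewrite Dab; apply: cvgD.
  by apply: (cvg_comp _ _ _ rd); rewrite bE; exact: at_right_shift.
apply: (@cvg_comp _ _ _ (fun y => y - p) g^`() _ (a^'+)).
  by rewrite bE; exact: at_right_shift.
by apply: cvg_within_filter; exact: cg.
Qed.

(** The recurrence makes the endpoint condition necessary as well, since
differentiating it at a relates the derivatives at a and b. *)
Lemma C1_recurrenceP a b v g : a < b -> Ck 1 g ->
  (forall x, v (x + (b - a)) = v x + g x) ->
  Ck 1 v <-> C1_segment a b v /\
    derive_within `[a, b] v b = derive_within `[a, b] v a + derive1 g a.
Proof.
move=> ab Cg vg; split=> [C1v|[seg Dab]]; last exact: C1_glue ab Cg vg seg Dab.
have [seg segE] := C1_line_segment ab C1v; split=> //.
rewrite !segE ?lexx ?ltW //.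
by have := derive1_recurrence (C1v.1 a) (Cg.1 a) vg; rewrite subrKC.
Qed.

(** * Antiderivatives of continuous functions *)

Lemma continuous_integrable_itv f a b :
  continuous f -> mu.-integrable `[a, b] (EFin \o f).
Proof.
move=> cf; apply: continuous_compact_integrable; first exact: segment_compact.
exact: continuous_subspaceT.
Qed.

Lemma Rintegral_itv_cat f a b c : continuous f -> a <= b <= c ->
  \int[mu]_(x in `[a, c]) f x =
  \int[mu]_(x in `[a, b]) f x + \int[mu]_(x in `[b, c]) f x.
Proof.
move=> cf /andP[ab bc].
have := @Rintegral_itvB _ f (BLeft a) (BRight c) b
  (continuous_integrable_itv a c cf).
rewrite !bnd_simp => /(_ ab bc) E.
rewrite -[LHS](subrK (\int[mu]_(x in `[a, b]) f x)) E addrC; congr (_ + _).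
apply: Rintegral_itv_obnd_cbnd.
apply: integrableS (continuous_integrable_itv b c cf) => //.
exact: subset_itv_oc_cc.
Qed.

Lemma continuous_antiderivative f : continuous f ->
  exists2 F : R -> R, (forall x, is_derive x 1 F (f x)) &
    forall a b, a <= b -> \int[mu]_(x in `[a, b]) f x = F b - F a.
Proof.
move=> cf; pose I a b := \int[mu]_(x in `[a, b]) f x.
have Icat a b c : a <= b <= c -> I a c = I a b + I b c.
  exact: Rintegral_itv_cat.
(* F x is the oriented integral from 0 to x; starting both integrals at a common
   point below 0 and x avoids the case distinction on the sign of x. *)
pose F x := I (Num.min 0 x) x - I (Num.min 0 x) 0.
have FE m x : m <= 0 -> m <= x -> F x = I m x - I m 0.
  move=> m0 mx; have mm : m <= Num.min 0 x by rewrite le_min m0.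
  rewrite /F (Icat m (Num.min 0 x) x) ?mm ?ge_min ?lexx ?orbT //.
  rewrite (Icat m (Num.min 0 x) 0) ?mm ?ge_min ?lexx //.
  by rewrite opprD addrACA subrr add0r.
exists F => [x|a b ab]; last first.
  have [m0 ma] : Num.min 0 a <= 0 /\ Num.min 0 a <= a.
    by rewrite !ge_min !lexx orbT.
  rewrite (FE _ b m0 (le_trans ma ab)) (FE _ a m0 ma).
  by rewrite (Icat _ a b) ?ma // -/(I a b); ring.
(* A base point strictly below x is valid for all y near x. *)
pose m := Num.min 0 x - 1.
have m0 : m <= 0 by rewrite /m lerBlDr ge_min lerDl ler01.
have mx : m < x by rewrite /m ltrBlDr gt_min ltrDl ltr01 orbT.
apply: (@near_eq_is_derive _ _ _ (fun y => I m y - I m 0)).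
  near=> y; rewrite (FE m) // ltW //; near: y; exact: lt_nbhsr.
have xx : x < x + 1 by rewrite ltrDl.
have [dI I'] := continuous_FTC1_closed xx
  (continuous_integrable_itv m (x + 1) cf) mx (cf x).
rewrite -[f x]subr0 -I'; apply: (@is_deriveB _ _ _ (I m) (cst (I m 0))).
exact: derivable_is_derive1.
Unshelve. all: by end_near. Qed.

(** * Travelling waves on the strip *)

Lemma wave_dt T F G (u : R -> R -> R) : 0 < T ->
  (forall x, derivable F x 1) -> (forall x, derivable G x 1) ->
  (forall t x, 0 <= t <= T -> u t x = F (x + t) + G (x - t)) ->
  forall t x, 0 <= t <= T ->
    derivable_within `[0, T] (u ^~ x) t /\
    dt T u t x = derive1 F (x + t) - derive1 G (x - t).
Proof.
move=> T0 dF dG uE t x tT.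
apply: (@is_derive_within _ _ _ (fun t => F (x + t) + G (x - t))) => // [s sT|].
  exact: uE.
rewrite [x + t]addrC; apply: is_deriveD.
  rewrite (_ : (fun s => F (x + s)) = (fun s => F (s + x))); last first.
    by apply/funext => s; rewrite addrC.
  exact: (is_derive_translate F x t _).1 (derivable_is_derive1 (dF _)).
rewrite -mulrN1; apply: (@is_derive1_comp _ G (fun s => x - s)).
  exact: derivable_is_derive1.
by rewrite -[X in is_derive _ _ _ X]add0r; apply: is_deriveB.
Qed.

Lemma wave_dx T F G (u : R -> R -> R) :
  (forall x, derivable F x 1) -> (forall x, derivable G x 1) ->
  (forall t x, 0 <= t <= T -> u t x = F (x + t) + G (x - t)) ->
  forall t x, 0 <= t <= T ->
    derivable (u t) x 1 /\ dx u t x = derive1 F (x + t) + derive1 G (x - t).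
Proof.
move=> dF dG uE t x tT.
suff D : is_derive x 1 (u t) (derive1 F (x + t) + derive1 G (x - t)).
  by split; [case: D | exact: is_derive_derive1].
rewrite (_ : u t = fun x => F (x + t) + G (x - t)); last first.
  by apply/funext => y; exact: uE.
apply: is_deriveD.
  exact: (is_derive_translate F t x _).1 (derivable_is_derive1 (dF _)).
exact: (is_derive_translate G (- t) x _).1 (derivable_is_derive1 (dG _)).
Qed.

Lemma wave_C0 T F G (u : R -> R -> R) : continuous F -> continuous G ->
  (forall t x, 0 <= t <= T -> u t x = F (x + t) + G (x - t)) -> C0_strip T u.
Proof.
move=> cF cG uE.
apply: (@subspace_eq_continuous _ _ _ (fun p : R * R => F (p.2 + p.1) + G (p.2 - p.1))).
  by move=> p; rewrite inE => /uE /esym.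
apply: continuous_subspaceT => p; apply: cvgD.
  apply: (@continuous_comp _ _ _ (fun p : R * R => p.2 + p.1) F); last exact: cF.
  by apply: cvgD; [exact: cvg_snd|exact: cvg_fst].
apply: (@continuous_comp _ _ _ (fun p : R * R => p.2 - p.1) G); last exact: cG.
by apply: cvgB; [exact: cvg_snd|exact: cvg_fst].
Qed.

(** Both partial derivatives of a travelling wave are travelling waves on the
strip, with profiles (F', -G') and (F', G'), one degree less smooth. *)
Lemma wave_Ck T k F G (u : R -> R -> R) : 0 < T -> Ck k F -> Ck k G ->
  (forall t x, 0 <= t <= T -> u t x = F (x + t) + G (x - t)) -> Ck_strip T k u.
Proof.
move=> T0; elim: k F G u => [|k IH] F G u; first exact: wave_C0.
move=> CF CG uE; have [[dF CF'] [dG CG']] := (CF, CG).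
split.
- by apply: wave_C0 uE; apply: Ck_continuous; eassumption.
- move=> t x tT; split; first by have [] := wave_dt T0 dF dG uE x tT.
  by have [] := wave_dx dF dG uE x tT.
- apply: IH CF' (CkN CG') _ => t x tT.
  by have [] := wave_dt T0 dF dG uE x tT.
- apply: IH CF' CG' _ => t x tT.
  by have [] := wave_dx dF dG uE x tT.
Qed.

(** * Inputs of solutions, and solutions from inputs *)

Lemma C0_strip_slice T (u : R -> R -> R) t : C0_strip T u -> 0 <= t <= T ->
  continuous (u t).
Proof.
move=> cu tT x.
have cux := (subspace_continuousP _ _).1 cu (t, x) tT.
have tx : (t, y) @[y --> x] --> within [set p : R * R | 0 <= p.1 <= T] (nbhs (t, x)).
  have c : (t, y) @[y --> x] --> (t, x).
    exact: (@cvg_pair _ _ _ (nbhs x) (nbhs t) (nbhs x) _ _ _ (cst t) id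
      (cvg_cst t) cvg_id).
  move=> U UE.
  have : \forall p \near within [set p : R * R | 0 <= p.1 <= T] (nbhs (t, x)),
    U p by [].
  rewrite near_withinE => {}UE.
  have : \forall y \near x, 0 <= t <= T -> U (t, y) by exact: c _ UE.
  move=> {}UE; suff : \forall y \near x, U (t, y) by [].
  exact: (@filterS _ (nbhs x) _ _ _ (fun y H => H tT) UE).
exact: (cvg_comp _ _ tx cux).
Qed.

(** The input of u is its own time derivative along t = 0, which a C^2 function
has differentiable in x. *)
Lemma input_C1 T (v : R -> R) (u : R -> R -> R) : 0 < T ->
  Ck_strip T 2 u -> has_input T u v -> Ck 1 v.
Proof.
move=> T0 [_ _ [_ dd _ cdx] _] uv.
have uvE : dt T u 0 = v by apply/funext => x; exact: uv.
have T00 : 0 <= (0 : R) <= T by rewrite lexx ltW.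
split=> [x|]; first by rewrite -uvE; have [] := dd 0 x T00.
by rewrite -uvE; exact: (C0_strip_slice cdx T00).
Qed.

(** The travelling wave form gives regularity, the wave equation, the initial
value and the input.  For the final value, the recurrence gives u(T,.) the
derivative of fT, and the integral condition the value of fT at 0. *)
Lemma induced_solution T (f0 fT v : R -> R) : 0 < T ->
  Ck 2 f0 -> Ck 1 fT -> Ck 1 v ->
  (forall x, v (x + T) =
    v (x - T) + 2 * derive1 fT x - derive1 f0 (x + T) - derive1 f0 (x - T)) ->
  \int[mu]_(x in `[- T, T]) v x = 2 * fT 0 - f0 T - f0 (- T) ->
  TBVP_solution T f0 fT (induced_function f0 v) /\
  has_input T (induced_function f0 v) v.
Proof.
move=> T_gt0 Cf CfT C1v v_rec int_v; have NTT : - T < T by rewrite gtrN.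
have [V dV VE] := continuous_antiderivative (Ck_continuous C1v).
have V'E : V^`() = v by apply/funext => x; exact: is_derive_derive1.
have CV : Ck 2 V by split; [move=> x; case: (dV x)|rewrite V'E].
pose F y := 2^-1 * (f0 y + V y); pose G y := 2^-1 * (f0 y + - V y).
have CF : Ck 2 F by exact: CkZ _ (CkD Cf CV).
have CG : Ck 2 G by exact: CkZ _ (CkD Cf (CkN CV)).
have uE t x : 0 <= t <= T -> induced_function f0 v t x = F (x + t) + G (x - t).
  move=> /andP[t0 _]; have xt : x - t <= x + t.
    by rewrite lerD2l (le_trans _ t0) // oppr_le0.
  by rewrite /induced_function (VE _ _ xt) /F /G; ring.
have [[dF [dF' _]] [dG [dG' _]]] := (CF, CG).
have dtE t x tT := (wave_dt T_gt0 dF dG uE (t := t) x tT).2.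
have dxE t x tT := (wave_dx dF dG uE (t := t) x tT).2.
have dG'N x : derivable (fun y => - derive1 G y) x 1 by exact: derivableN.
have G'N x : derive1 (fun y => - derive1 G y) x = - derive1 (derive1 G) x.
  by apply: is_derive_derive1; apply: is_deriveN; exact: derivable_is_derive1.
have F'E x : derive1 F x = 2^-1 * (derive1 f0 x + v x).
  apply: is_derive_derive1; apply: (@is_deriveZ _ _ _ (fun y => f0 y + V y)).
  by apply: is_deriveD; exact: derivable_is_derive1 (Cf.1 x).
have G'E x : derive1 G x = 2^-1 * (derive1 f0 x - v x).
  apply: is_derive_derive1; apply: (@is_deriveZ _ _ _ (fun y => f0 y - V y)).
  by apply: is_deriveB; exact: derivable_is_derive1 (Cf.1 x).
have T00 : 0 <= (0 : R) <= T by rewrite lexx ltW.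
have T0T : 0 <= T <= T by rewrite lexx ltW.
split; last first.
  by move=> x; rewrite dtE // addr0 subr0 F'E G'E; field.
split.
- exact: wave_Ck T_gt0 CF CG uE.
- move=> t x tT.
  rewrite (wave_dt T_gt0 dF' dG'N dtE x tT).2 (wave_dx dF' dG' dxE x tT).2 G'N.
  by rewrite opprK subrr.
- by move=> x; rewrite uE // addr0 subr0 /F /G; field.
- move=> x; rewrite uE //.
  (* h is u(T,.) as a function of x. *)
  pose h : R -> R := fun y => F (y + T) + G (y - T).
  have dh (y : R) : is_derive y 1 h (derive1 F (y + T) + derive1 G (y - T)).
    apply: is_deriveD.
      exact: (is_derive_translate F T y _).1 (derivable_is_derive1 (dF _)).
    exact: (is_derive_translate G (- T) y _).1 (derivable_is_derive1 (dG _)).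
  suff : h = fT by move/(congr1 (fun f => f x)).
  apply: derive1_inj_at0 => [y|||]; first by case: (dh y).
  - exact: CfT.1.
  - by apply/funext => y; rewrite (is_derive_derive1 (dh y)) F'E G'E v_rec; field.
  rewrite /h /= add0r sub0r /F /G.
  by rewrite -[V T](subrK (V (- T))) -(VE _ _ (ltW NTT)) int_v; field.
Qed.

Definition period_increment T (f0 fT : R -> R) : R -> R := fun y =>
  2 * derive1 fT (y + T) - derive1 f0 (y + (T + T)) - derive1 f0 y.

Lemma period_increment_C1 T (f0 fT : R -> R) : Ck 2 f0 -> Ck 2 fT ->
  Ck 1 (period_increment T f0 fT).
Proof.
move=> [_ Cf0'] [_ CfT'].
exact (CkD (CkD (CkZ 2 (Ck_translate T (CfT' : Ck 1 (derive1 fT))))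
  (CkN (Ck_translate (T + T) (Cf0' : Ck 1 (derive1 f0)))))
  (CkN (Cf0' : Ck 1 (derive1 f0)))).
Qed.

Lemma derive1_period_increment T (f0 fT : R -> R) : Ck 2 f0 -> Ck 2 fT ->
  derive1 (period_increment T f0 fT) (- T) =
  2 * derive1n 2 fT 0 - derive1n 2 f0 T - derive1n 2 f0 (- T).
Proof.
move=> [_ [df0' _]] [_ [dfT' _]]; apply: is_derive_derive1.
apply: is_deriveB; last exact: derivable_is_derive1.
have -> : derive1n 2 f0 T = derive1 (derive1 f0) (- T + (T + T)) by rewrite addKr.
have -> : derive1n 2 fT 0 = derive1 (derive1 fT) (- T + T) by rewrite addNr.
apply: is_deriveB; last first.
  exact: (is_derive_translate _ (T + T) (- T) _).1 (derivable_is_derive1 (df0' _)).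
apply: (@is_deriveZ _ _ _ (fun y => derive1 fT (y + T))).
exact: (is_derive_translate _ T (- T) _).1 (derivable_is_derive1 (dfT' _)).
Qed.

Lemma period_incrementE T (f0 fT v : R -> R) :
  (forall x, v (x + T) =
    v (x - T) + 2 * derive1 fT x - derive1 f0 (x + T) - derive1 f0 (x - T)) ->
  forall x, v (x + (T - - T)) = v x + period_increment T f0 fT x.
Proof.
move=> v_rec x.
by rewrite opprK addrA v_rec -addrA addrK /period_increment addrA !addrA.
Qed.

End Calculus.

Theorem theorem1 (R : realType) (T : R) (f0 fT v : R -> R)
  (T_gt0 : 0 < T) (f0_smooth : smooth f0) (fT_smooth : smooth fT)
  (v_int : loc_integrable v)
  (v_rec : forall x : R,
    v (x + T) = v (x - T) + 2 * derive1 fT x - derive1 f0 (x + T) - derive1 f0 (x - T)) :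
  (TBVP_solution T f0 fT (induced_function f0 v) /\ has_input T (induced_function f0 v) v) <->
  [/\ \int[@lebesgue_measure R]_(x in `[- T, T]) v x
        = 2 * fT 0 - f0 T - f0 (- T),
      C1_segment (- T) T v,
      v T = v (- T) + 2 * derive1 fT 0 - derive1 f0 T - derive1 f0 (- T) &
      derive_within `[- T, T] v T
        = derive_within `[- T, T] v (- T)
          + 2 * derive1n 2 fT 0 - derive1n 2 f0 T - derive1n 2 f0 (- T)].
Proof.
have NTT : - T < T by rewrite gtrN.
have Cf k := smooth_Ck k f0_smooth; have CfT k := smooth_Ck k fT_smooth.
have vg := period_incrementE v_rec.
have Cg := period_increment_C1 T (Cf 2%N) (CfT 2%N).
have C1P := C1_recurrenceP NTT Cg vg.
have g'E := derive1_period_increment T (Cf 2%N) (CfT 2%N).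
split.
  move=> [[C2 _ _ final] uv].
  have [seg Dv] := C1P.1 (input_C1 T_gt0 C2 uv).
  split=> //.
  - by have := final 0; rewrite /induced_function add0r sub0r => <-; field.
  - by have := v_rec 0; rewrite add0r sub0r.
  - by rewrite Dv g'E !addrA.
move=> [int_v seg _ Dv].
have C1v : Ck 1 v by apply: C1P.2; split=> //; rewrite Dv g'E !addrA.
exact: induced_solution T_gt0 (Cf 2%N) (CfT 1%N) C1v v_rec int_v.
Qed.
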